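(* Let $f:\mathbb{R}^n\to\mathbb{R}$ be convex and locally smooth, with nonempty set of minimizers $X^\star$ and optimal value $f^\star>-\infty$. Let $x_0\in\mathbb{R}^n$, $\alpha_{-1}>0$, and for each $k\in\mathbb{N}$ let $\gamma_k\in(0,1)$ and $a_k\in(0,\gamma_k]$. Let $(x_k)_{k\in\mathbb{N}}$ be generated by gradient descent $x_{k+1}=x_k-\alpha_k\nabla f(x_k)$, $k\in\mathbb{N}$, with positive stepsizes satisfying $$\alpha_k=\frac{\gamma_k}{a_kL_k},\qquad L_k=\frac{\|\nabla f(x_{k+1})-\nabla f(x_k)\|}{\|x_{k+1}-x_k\|}.$$ Let $F_k=f(x_k)-f^\star$ and, for $x^\star\in X^\star$, $$V^{\mathrm p}_k(x^\star)=\|x_k-x^\star\|^2+\frac{\alpha_{k-1}^2}{\alpha_k^2}\|x_{k+1}-x_k\|^2 .$$ Then for every $x^\star\in X^\star$ and $k\in\mathbb{N}$, $$V^{\mathrm p}_{k+1}(x^\star)-V^{\mathrm p}_k(x^\star)\le-\left(\frac{\alpha_{k-1}^2}{\alpha_k^2}-\frac{\gamma_k^2}{a_k^2}\right)\|x_{k+1}-x_k\|^2-2\alpha_kF_{k+1}.$$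
   Context: $\mathbb{N}=\{0,1,2,\dots\}$, and $\|\cdot\|$ is the Euclidean norm. A function $f:\mathbb{R}^n\to\mathbb{R}$ is locally smooth if it is differentiable and for every convex compact set $D\subset\mathbb{R}^n$ there is $L_D\in(0,\infty)$ with $\|\nabla f(y)-\nabla f(x)\|\le L_D\|y-x\|$ for all $x,y\in D$. $X^\star$ is the set of minimizers of $f$ over $\mathbb{R}^n$ and $f^\star=\min f$. The quantity $L_k$ depends on $x_{k+1}$ and hence on $\alpha_k$, so the stepsize law is an implicit condition on $\alpha_k$; it is assumed that the sequences satisfy it, with each $L_k$ well defined and positive (in particular $x_{k+1}\ne x_k$). *)

(* Defs.v *)
From mathcomp Require Export all_boot all_order all_algebra.
From mathcomp Require Export all_classical all_reals all_analysis.
Export Order.TTheory GRing.Theory Num.Theory.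
Export numFieldNormedType.Exports.

Set Implicit Arguments.
Unset Strict Implicit.
Unset Printing Implicit Defensive.

Local Open Scope classical_set_scope.
Local Open Scope ring_scope.

(* The library norm `|x| on 'rV[R]_n is the sup norm; it induces the same
   topology (hence the same differentiable functions and compact sets), but
   metric quantities must use the Euclidean norm. *)
Definition enorm (R : realType) (n : nat) (x : 'rV[R]_n) : R :=
  Num.sqrt (\sum_(i < n) x 0 i ^+ 2).

Definition grad (R : realType) (n : nat) (f : 'rV[R]_n -> R) (x : 'rV[R]_n) :
  'rV[R]_n := \row_(i < n) 'D_(delta_mx 0 i) f x.

Definition convex_fun (R : realType) (n : nat) (f : 'rV[R]_n -> R) : Prop :=
  @convex_function R 'rV[R]_n setT f.

Definition locally_smooth (R : realType) (n : nat) (f : 'rV[R]_n -> R) : Prop :=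
  (forall x, differentiable f x) /\
  (forall D : set 'rV[R]_n, @convex_set R 'rV[R]_n D -> compact D ->
     exists2 L : R, 0 < L &
       forall x y, D x -> D y ->
         enorm (grad f y - grad f x) <= L * enorm (y - x)).

Definition minimizers (R : realType) (n : nat) (f : 'rV[R]_n -> R) :
  set 'rV[R]_n := [set x | forall y, f x <= f y].

(* [inf] is the real-valued infimum: it is meaningful only when [range f] is
   bounded below, and is the minimum of f as soon as f has a minimizer. *)
Definition optval (R : realType) (n : nat) (f : 'rV[R]_n -> R) : R :=
  inf (range f).

Definition gap (R : realType) (n : nat) (f : 'rV[R]_n -> R)
  (x : nat -> 'rV[R]_n) (k : nat) : R := f (x k) - optval f.

Definition local_lip (R : realType) (n : nat) (f : 'rV[R]_n -> R)
  (x : nat -> 'rV[R]_n) (k : nat) : R :=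
  enorm (grad f (x k.+1) - grad f (x k)) / enorm (x k.+1 - x k).

(* alpha_{k-1}, where [am1] stands for alpha_{-1}. *)
Definition prev_step (R : realType) (am1 : R) (alpha : nat -> R) (k : nat) : R :=
  if k is j.+1 then alpha j else am1.

Definition lyapunov (R : realType) (n : nat) (x : nat -> 'rV[R]_n)
  (am1 : R) (alpha : nat -> R) (k : nat) (xs : 'rV[R]_n) : R :=
  enorm (x k - xs) ^+ 2
  + prev_step am1 alpha k ^+ 2 / alpha k ^+ 2 * enorm (x k.+1 - x k) ^+ 2.

(* Main.v *)
(** Since [alpha_k * local_lip k = gamma_k / a_k], both quadratic terms of the
    claim are multiples of squared gradient norms; with [g = grad f (x k)] and
    [g' = grad f (x k.+1)], expanding the squares reduces the claim to
    [f (x k.+1) - f xs <= <g, x k - xs> - alpha_k <g', g>], which is the sum of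
    the convexity inequalities [f (x k) - f xs <= <g, x k - xs>] and
    [f (x k.+1) - f (x k) <= <g', x k.+1 - x k>]. *)
Require Import Defs.
From mathcomp Require Import ring lra.

Set Implicit Arguments.
Unset Strict Implicit.
Unset Printing Implicit Defensive.

Local Open Scope classical_set_scope.
Local Open Scope ring_scope.

Definition dotv (R : pzSemiRingType) (n : nat) (u v : 'rV[R]_n) : R :=
  \sum_(i < n) u 0 i * v 0 i.

Lemma dotvC (R : comPzSemiRingType) (n : nat) (u v : 'rV[R]_n) :
  dotv u v = dotv v u.
Proof. by apply: eq_bigr => i _; rewrite mulrC. Qed.

Lemma dotvDl (R : pzSemiRingType) (n : nat) (u v w : 'rV[R]_n) :
  dotv (u + v) w = dotv u w + dotv v w.
Proof. by rewrite -big_split; apply: eq_bigr => i _; rewrite mxE mulrDl. Qed.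

Lemma dotvZl (R : pzSemiRingType) (n : nat) (c : R) (u v : 'rV[R]_n) :
  dotv (c *: u) v = c * dotv u v.
Proof. by rewrite mulr_sumr; apply: eq_bigr => i _; rewrite mxE mulrA. Qed.

Lemma sqr_enorm (R : realType) (n : nat) (u : 'rV[R]_n) :
  enorm u ^+ 2 = dotv u u.
Proof.
by rewrite sqr_sqrtr ?sumr_ge0// => i _; rewrite sqr_ge0.
Qed.

Lemma sqr_enormZ (R : realType) (n : nat) (c : R) (u : 'rV[R]_n) :
  enorm (c *: u) ^+ 2 = c ^+ 2 * enorm u ^+ 2.
Proof. by rewrite !sqr_enorm dotvZl dotvC dotvZl expr2 mulrA. Qed.

(** The scalar is kept apart so that one expansion serves the gradient step, with [c = - alpha k],
    and the gradient difference, with [c = -1]. *)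
Lemma sqr_enormDZ (R : realType) (n : nat) (c : R) (u v : 'rV[R]_n) :
  enorm (u + c *: v) ^+ 2 =
  enorm u ^+ 2 + 2 * c * dotv v u + c ^+ 2 * enorm v ^+ 2.
Proof.
rewrite !sqr_enorm dotvDl ![dotv _ (_ + _)]dotvC !dotvDl !dotvZl.
rewrite ![dotv _ (c *: v)]dotvC !dotvZl; ring.
Qed.

(** The differential is linear, so its value at [v] follows from its values on the basis vectors,
    which are the entries of [grad]. *)
Lemma deriveE_grad (R : realType) (n : nat) (f : 'rV[R]_n -> R)
  (x v : 'rV[R]_n) : differentiable f x -> 'D_v f x = dotv (grad f x) v.
Proof.
move=> df; rewrite deriveE// [in LHS](row_sum_delta v) linear_sum.
by apply: eq_bigr => i _; rewrite linearZ mxE deriveE// mulrC.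
Qed.

Lemma convex_grad_le (R : realType) (n : nat) (f : 'rV[R]_n -> R)
  (x y : 'rV[R]_n) : convex_fun f -> differentiable f x ->
  dotv (grad f x) (y - x) <= f y - f x.
Proof.
move=> cf df; rewrite -deriveE_grad//.
have dfv : derivable f x (y - x) by exact: diff_derivable.
(* It suffices to bound the difference quotient for small [h > 0]; there convexity, with weight [h]
   on [y], bounds it by the chord slope. *)
apply: (cvgr_to_le (cvg_dnbhs_at_right dfv)); near=> h.
have h_gt0 : 0 < h by near: h; exact: nbhs_right_gt.
have h_le1 : h <= 1 by near: h; exact: nbhs_right_le.
have := cf (Itv01 (ltW h_gt0) h_le1) y x (mem_set I) (mem_set I).
rewrite convRE /= /conv /= /unstable.onem.
have -> : h *: y + (1 - h) *: x = h *: (y - x) + x.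
  by rewrite scalerBl scale1r scalerBr addrA addrAC.
rewrite -[h^-1 *: _]/(h^-1 * _) ler_pdivrMl// => le_f.
lra.
Unshelve. all: by end_near. Qed.

Lemma optval_minimizer (R : realType) (n : nat) (f : 'rV[R]_n -> R)
  (xs : 'rV[R]_n) : minimizers f xs -> optval f = f xs.
Proof.
move=> xs_min; have lb_xs : lbound (range f) (f xs).
  by move=> _ [y _ <-]; exact: xs_min.
apply/eqP; rewrite eq_le; apply/andP; split.
  by apply: ge_inf; [exists (f xs) | exists xs].
by apply: lb_le_inf => //; exists (f xs), xs.
Qed.

Theorem lemma3 (R : realType) (n : nat) (f : 'rV[R]_n -> R)
  (f_convex : convex_fun f)
  (f_smooth : locally_smooth f)
  (f_min : minimizers f !=set0)
  (f_bounded : has_lbound (range f))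
  (x : nat -> 'rV[R]_n) (am1 : R) (alpha gamma a : nat -> R)
  (am1_gt0 : 0 < am1)
  (gamma_itv : forall k, 0 < gamma k /\ gamma k < 1)
  (a_itv : forall k, 0 < a k /\ a k <= gamma k)
  (gd : forall k, x k.+1 = x k - alpha k *: grad f (x k))
  (alpha_gt0 : forall k, 0 < alpha k)
  (x_neq : forall k, x k.+1 <> x k)
  (lip_gt0 : forall k, 0 < local_lip f x k)
  (alpha_law : forall k, alpha k = gamma k / (a k * local_lip f x k)) :
  forall (xs : 'rV[R]_n) (k : nat), minimizers f xs ->
    lyapunov x am1 alpha k.+1 xs - lyapunov x am1 alpha k xs
    <= - (prev_step am1 alpha k ^+ 2 / alpha k ^+ 2 - gamma k ^+ 2 / a k ^+ 2)
         * enorm (x k.+1 - x k) ^+ 2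
       - 2 * alpha k * gap f x k.+1.
Proof.
move=> xs k xs_min.
have gap_k : gap f x k.+1 = f (x k.+1) - f xs.
  by rewrite /gap (optval_minimizer xs_min).
have cvx_xs := convex_grad_le xs f_convex (f_smooth.1 (x k)).
(* The tangent is taken at [x k.+1], so that the cross term of both gradients appears. *)
have cvx_x := convex_grad_le (x k) f_convex (f_smooth.1 (x k.+1)).
have stepE j : x j.+1 - x j = - alpha j *: grad f (x j).
  by rewrite gd addrAC subrr add0r scaleNr.
have lip_eq : gamma k ^+ 2 / a k ^+ 2 * enorm (x k.+1 - x k) ^+ 2
    = alpha k ^+ 2 * enorm (grad f (x k.+1) - grad f (x k)) ^+ 2.
  (* Division by zero yields 0, so a positive [local_lip] forces a nonzero denominator. *)
  have e_neq0 : enorm (x k.+1 - x k) != 0.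
    apply/eqP => e0; have := lip_gt0 k.
    by rewrite /local_lip e0 invr0 mulr0 ltxx.
  have [a_gt0 _] := a_itv k.
  have -> : gamma k = alpha k * (a k * local_lip f x k).
    by rewrite alpha_law divfK// gt_eqF// mulr_gt0.
  rewrite /local_lip; field.
  by rewrite e_neq0 gt_eqF.
(* The next step has length [alpha k.+1] times the gradient norm, so [alpha k.+1] cancels. *)
have next_eq : alpha k ^+ 2 / alpha k.+1 ^+ 2 * enorm (x k.+2 - x k.+1) ^+ 2
    = alpha k ^+ 2 * enorm (grad f (x k.+1)) ^+ 2.
  rewrite stepE sqr_enormZ; field.
  by rewrite gt_eqF.
have dist_eq : x k.+1 - xs = (x k - xs) + - alpha k *: grad f (x k).
  by rewrite gd addrAC scaleNr.
have diff_eq : grad f (x k.+1) - grad f (x k)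
    = grad f (x k.+1) + -1 *: grad f (x k) by rewrite scaleN1r.
have cvx_sum : f (x k.+1) - f xs <= dotv (grad f (x k)) (x k - xs)
    - alpha k * dotv (grad f (x k)) (grad f (x k.+1)).
  have xsE : xs - x k = -1 *: (x k - xs) by rewrite scaleN1r opprB.
  have xE : x k - x k.+1 = alpha k *: grad f (x k).
    by rewrite -opprB stepE scaleNr opprK.
  move: cvx_xs cvx_x.
  by rewrite xsE xE ![dotv _ (_ *: _)]dotvC !dotvZl [dotv (x k - xs) _]dotvC; lra.
rewrite gap_k opprB mulrBl lip_eq /lyapunov /= next_eq diff_eq dist_eq.
(* The [prev_step] terms and the squared gradient norms cancel on both sides; what remains is
   [cvx_sum] times [2 * alpha k]. *)
rewrite !sqr_enormDZ; move: cvx_sum; rewrite -(ler_pM2l (alpha_gt0 k)); lra.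
Qed.
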